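(* Suppose that $f^0,\dots,f^N$ and $\eta$ satisfy (H1)–(H5) as listed in the context, and let $x$ be a backwards-bounded entire solution of $$\dot x^{i}(t)=f^{i}(t,x^i(t),x^{i+1}(t))\ (0\le i\le N-1),\qquad \dot x^N(t)=f^N(t,x^N(t),x^0(\eta(t))).$$ (i) If there exists $\sigma\in\mathbb R$ such that $x(\eta^k(\sigma))=0\in\mathbb R^{N+1}$ for all integers $k\ge0$, then $x(t)=0$ for all $t\in\mathbb R$. (ii) If $x$ is nontrivial (not identically zero), then $V(x_t,-\tau(t))$ is finite for all $t\in\mathbb R$.
   Context: Fix an integer $N\ge 0$, a real $r>0$, and $\delta\in\{1,-1\}$. Real-valued functions $f^0,\dots,f^N$ of three real variables $(t,u,v)$ and $\eta:\mathbb R\to\mathbb R$ are given; $D_j$ is the partial derivative with respect to the $j$-th argument; $\eta^k$ denotes the $k$-th iterate of $\eta$ ($\eta^0=\mathrm{id}$). For $N=0$ the system is the single equation $\dot x^0(t)=f^0(t,x^0(t),x^0(\eta(t)))$. (H1) The functions $f^0,\dots,f^N$ are continuous in their first argument, and $C^1$ in their other arguments. (H2) For all $t$ and all $v\ne 0$: $v f^i(t,0,v)>0$ and $D_3f^i(t,0,0)>0$ for $0\le i\le N-1$; $\delta v f^N(t,0,v)>0$ and $\delta D_3f^N(t,0,0)>0$. (H3) $\eta$ is continuous and strictly increasing, and the delay $\tau(t):=t-\eta(t)$ satisfies $0<\tau(t)\le r$ for all $t\in\mathbb R$. (H4) For any bounded set $B\subset\mathbb R^2$ there is a constant $C=C(B)>0$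 such that $|f^i(t,u,v)|\le C(|u|+|v|)$ for all $0\le i\le N$, $t\in\mathbb R$ and $(u,v)\in B$. (H5) There is a constant $L>0$ such that all iterates $\eta^k$, $k\in\mathbb N$, are Lipschitz continuous with constant $L$. An entire solution is $x=(x^0,\dots,x^N)$ with $C^1$ functions $x^i:\mathbb R\to\mathbb R$ satisfying the system for all $t\in\mathbb R$; it is backwards-bounded if it is bounded on $(-\infty,t]$ for every $t\in\mathbb R$. Phase space: $\mathbb K=[-r,0]\cup\{1,\dots,N\}$ and $\mathcal C_{\mathbb K}=C(\mathbb K,\mathbb R)$. The segment $x_t\in\mathcal C_{\mathbb K}$ is $x_t(s)=x^0(t+s)$ for $s\in[-r,0]$ and $x_t(s)=x^s(t)$ for $s\in\{1,\dots,N\}$. Sign changes: for $\varphi\in\mathcal C_{\mathbb K}\setminus\{0\}$ and $a\in[-r,0)$, $\mathrm{sc}(\varphi,a)\in\{0,1,2,\dots\}\cup\{\infty\}$ is the supremum of all integers $k\ge1$ for which there exist $\theta_k<\theta_{k-1}<\dots<\theta_0$ in $[a,0]\cup\{1,\dots,N\}$ with $\varphi(\theta_i)\varphi(\theta_{i-1})<0$ for $1\le i\le k$ (with $\sup\emptyset=0$). If $\delta=1$, $V(\varphi,a)$ equals $\mathrm{sc}(\varphi,a)$ if this is even or infinite, and $\mathrm{sc}(\varphi,a)+1$ if it is odd. If $\delta=-1$, $V(\varphi,a)$ equals $\mathrm{sc}(\varphi,a)$ if this is odd or infinite, and $\mathrm{sc}(\varphi,a)+1$ if it is even. *)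

(* Defs.v *)
From HB Require Import structures.
From mathcomp Require Import all_boot all_order all_algebra.
From mathcomp Require Import all_classical all_reals all_analysis.
Set Implicit Arguments.
Unset Strict Implicit.
Unset Printing Implicit Defensive.
Import Order.TTheory GRing.Theory Num.Theory.
Import numFieldNormedType.Exports.
Local Open Scope classical_set_scope.
Local Open Scope ring_scope.

Section System.
Context {R : realType}.

Definition D2 (f : R -> R -> R -> R) (t u v : R) : R :=
  derive1 (fun w => f t w v) u.
Definition D3 (f : R -> R -> R -> R) (t u v : R) : R :=
  derive1 (fun w => f t u w) v.

(* The regularity is separate: continuity in t for each fixed (u, v), and
   joint C^1 regularity in (u, v) for each fixed t. *)
Definition H1 (N : nat) (f : 'I_N.+1 -> R -> R -> R -> R) : Prop :=
  forall i : 'I_N.+1,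
    (forall u v : R, continuous (fun t => f i t u v)) /\
    (forall t : R,
      [/\ forall u v : R, derivable (fun w => f i t w v) u 1,
          forall u v : R, derivable (fun w => f i t u w) v 1,
          continuous (fun p : R * R => D2 (f i) t p.1 p.2) &
          continuous (fun p : R * R => D3 (f i) t p.1 p.2)]).

Definition H2 (N : nat) (delta : R) (f : 'I_N.+1 -> R -> R -> R -> R) : Prop :=
  (forall i : 'I_N.+1, (i < N)%N -> forall t : R,
     (forall v : R, v != 0 -> 0 < v * f i t 0 v) /\ 0 < D3 (f i) t 0 0) /\
  (forall t : R,
     (forall v : R, v != 0 -> 0 < delta * v * f ord_max t 0 v) /\
     0 < delta * D3 (f ord_max) t 0 0).

Definition delay (eta : R -> R) (t : R) : R := t - eta t.

Definition H3 (r : R) (eta : R -> R) : Prop :=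
  [/\ continuous eta,
      {homo eta : s t / s < t} &
      forall t : R, 0 < delay eta t <= r].

Definition H4 (N : nat) (f : 'I_N.+1 -> R -> R -> R -> R) : Prop :=
  forall B : set (R * R), bounded_set B ->
    exists2 C : R, 0 < C &
      forall (i : 'I_N.+1) (t u v : R), B (u, v) ->
        `|f i t u v| <= C * (`|u| + `|v|).

Definition H5 (eta : R -> R) : Prop :=
  exists2 L : R, 0 < L & forall k : nat, L.-lipschitz (iter k eta).

Definition entire_solution (N : nat) (f : 'I_N.+1 -> R -> R -> R -> R)
    (eta : R -> R) (x : 'I_N.+1 -> R -> R) : Prop :=
  [/\ forall i : 'I_N.+1,
        (forall t : R, derivable (x i) t 1) /\ continuous (derive1 (x i)),
      forall i j : 'I_N.+1, j = i.+1 :> nat ->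
        forall t : R, derive1 (x i) t = f i t (x i t) (x j t) &
      forall t : R,
        derive1 (x ord_max) t = f ord_max t (x ord_max t) (x ord0 (eta t))].

Definition backwards_bounded (N : nat) (x : 'I_N.+1 -> R -> R) : Prop :=
  forall (t : R) (i : 'I_N.+1), [bounded x i s | s in `]-oo, t]].

(* [a, 0] together with {1, ..., N}, as a subset of the real line; the space
   K of the delay r is [domK N (- r)]. *)
Definition domK (N : nat) (a : R) : set R :=
  `[a, 0] `|` [set j%:R | j in [set j : nat | (1 <= j <= N)%N]].

(* The nonzero elements of C(K, R).  A function on K is represented by a
   function on R, of which only the values on K matter. *)
Definition nonzeroCK (N : nat) (r : R) : set (R -> R) :=
  [set phi | {within domK N (- r), continuous phi} /\
             exists2 s, domK N (- r) s & phi s != 0].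

(* Positive points of K are integers, and Num.truncn reads off their value;
   the values outside K are irrelevant. *)
Definition segment (N : nat) (x : 'I_N.+1 -> R -> R) (t s : R) : R :=
  if s <= 0 then x ord0 (t + s) else x (inord (Num.truncn s)) t.

(* The natural numbers extended with a point at infinity. *)
Inductive natinf : Type := Fin of nat | Infty.

(* Least upper bound in natinf of a set of natural numbers; the default value
   of supremum makes it 0 on the empty set. *)
Definition natsup (A : set nat) : natinf :=
  if `[< has_ubound A >] then Fin (supremum 0%N A) else Infty.

Definition sc (N : nat) (phi : R -> R) (a : R) : natinf :=
  natsup [set k : nat | (1 <= k)%N /\
    exists theta : nat -> R,
      (forall i, (i <= k)%N -> domK N a (theta i)) /\
      (forall i, (1 <= i <= k)%N ->
         theta i < theta i.-1 /\ phi (theta i) * phi (theta i.-1) < 0)].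

Definition V (N : nat) (delta : R) (phi : R -> R) (a : R) : natinf :=
  match sc N phi a with
  | Fin n => if delta == 1 then Fin (if odd n then n.+1 else n)
             else Fin (if odd n then n else n.+1)
  | Infty => Infty
  end.

End System.

(* Main.v *)
Require Import Defs.
From HB Require Import structures.
From mathcomp Require Import all_boot all_order all_algebra.
From mathcomp Require Import all_classical all_reals all_analysis.
From mathcomp Require Import ring lra.
Set Implicit Arguments.
Unset Strict Implicit.
Unset Printing Implicit Defensive.
Import Order.TTheory GRing.Theory Num.Theory.
Import numFieldNormedType.Exports.
Local Open Scope classical_set_scope.
Local Open Scope ring_scope.

(* (i) If [x] vanishes at all the points eta^k(sigma), then (H4), the mean value
   theorem and the common Lipschitz constant of the iterates of [eta] force [x]
   to vanish at eta^k(p) for all [k] and all [p] in [sigma, sigma + h], where [h]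
   depends only on an upper bound of [p].  This spreads the zeros to
   [sigma, +oo[, and hence to the whole line, as eta^k(sigma) tends to -oo.

   (ii) By the sign condition (H2), between two zeros of a component there is a
   zero of the component (or of the delayed component) that feeds it.  So a limit
   point [s] of zeros of x^0 is a limit point of zeros of every component, and
   eta(s) is again a limit point of zeros of x^0; thus [x] vanishes at all
   eta^k(s), and [x] is trivial by (i).  Infinitely many sign changes, or a zero
   segment, would produce such a limit point. *)

(** * Zeros of a real function and the sign of its derivative there *)

Lemma derive1_sign_near (R : realType) (w : R -> R) (c p : R) :
  derivable w p 1 -> 0 < c * derive1 w p ->
  exists2 e, 0 < e & forall q, q != p -> `|q - p| < e ->
    0 < c * ((q - p) * (w q - w p)).
Proof.
rewrite derive1E => dw c_dw.
have lim_q : h^-1 *: (w (h + p) - w p) @[h --> 0^'] --> 'D_1 w p.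
  suff -> : (fun h : R => h^-1 *: (w (h + p) - w p)) =
            (fun h => h^-1 *: ((w \o shift p) (h *: 1) - w p)) by exact: dw.
  by apply/funext => h /=; rewrite [h *: 1]mulr1.
have lim_cq : c * (h^-1 * (w (h + p) - w p)) @[h --> 0^'] --> c * 'D_1 w p.
  by apply: cvgM lim_q; exact: cvg_cst.
have := cvgr_gt _ lim_cq _ c_dw.
move=> [e e0 near_q]; exists e => // q qp q_e.
have qp0 : q - p != 0 by rewrite subr_eq0.
have := near_q (q - p); rewrite /ball /= sub0r normrN subrK => /(_ q_e qp0).
move=> pos.
have -> : c * ((q - p) * (w q - w p)) =
    (q - p) ^+ 2 * (c * ((q - p)^-1 * (w q - w p))) by field.
by rewrite pmulr_rgt0// exprn_even_gt0.
Qed.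

(** If the derivative of [c * w] is positive at [b], then [c * w] is negative at some [m] just left
    of [b]. At the last point of [[a, m]] where [c * w >= 0], this function vanishes and then
    becomes negative, so its derivative there is not positive. *)
Lemma zero_derive1_sign (R : realType) (w : R -> R) (c a b : R) :
  (forall t, derivable w t 1) -> a < b -> w a = 0 -> w b = 0 ->
  exists2 p, a <= p <= b & w p = 0 /\ c * derive1 w p <= 0.
Proof.
move=> dw ab wa wb; have [?|cb] := leP (c * derive1 w b) 0.
  by exists b => //; rewrite ltW/=.
have wcont : continuous w.
  by move=> t; apply/differentiable_continuous/derivable1_diffP.
have [e e0 near_b] := derive1_sign_near (dw b) cb.
have [m /andP[am mb] cwm] : exists2 m, a < m < b & c * w m < 0.
  pose m := Num.max ((a + b) / 2) (b - e / 2).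
  have mb : m < b by rewrite /m gt_max; apply/andP; split; lra.
  have am : a < m by rewrite /m lt_max; apply/orP; left; lra.
  have bm : b - e / 2 <= m by rewrite /m le_max lexx orbT.
  exists m; first by rewrite am mb.
  have := near_b m; rewrite lt_eqF// => /(_ isT).
  rewrite ltr0_norm ?subr_lt0// => /(_ _); rewrite wb subr0 mulrCA.
  by rewrite nmulr_rgt0 ?subr_lt0//; apply; lra.
pose S := [set t | 0 <= c * w t] `&` `[a, m].
have cS : compact S.
  rewrite /S setIC; apply: compact_closedI; first exact: segment_compact.
  have -> : [set t | 0 <= c * w t] = (fun t => c * w t) @^-1` [set y | 0 <= y] by [].
  apply: preimage_closed (@closed_ge R 0) => t _.
  by apply: cvgM; [exact: cvg_cst|exact: wcont].
have Sa : S a by split; rewrite /= ?wa ?mulr0// in_itv/= lexx ltW.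
have [p /set_mem[/= wp0]] := compact_EVT_max (ex_intro _ a Sa) cS
  (continuous_subspaceT (fun x => @cvg_id _ _)).
rewrite in_itv/= => /andP[ap pm] pmax.
have {}pm : p < m.
  by rewrite lt_neqAle pm andbT; apply: contraTN cwm => /eqP <-; rewrite -leNgt.
have neg t : p < t -> t <= m -> c * w t < 0.
  move=> pt tm; rewrite ltNge; apply/negP => cwt.
  have : t <= p by apply: pmax; apply/mem_set; split; rewrite //= in_itv/= tm (ltW (le_lt_trans ap pt)).
  by rewrite leNgt pt.
(* The intermediate value theorem gives a zero of [c * w] in [[p, m]], and by [neg] it can only be
   [p]. *)
have cwp : c * w p = 0.
  have [z /[!in_itv]/= /andP[pz zm] cwz] : exists2 z, z \in `[p, m] & c * w z = 0.
    apply: (@IVT _ (fun t => c * w t)); first exact: ltW.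
      by apply: continuous_subspaceT => t; apply: cvgM; [exact: cvg_cst|exact: wcont].
    by rewrite ge_min le_max wp0 (ltW cwm) orbT.
  move: pz; rewrite le_eqVlt => /predU1P[->//|pz].
  by have := neg _ pz zm; rewrite cwz ltxx.
have c0 : c != 0 by apply: contraTneq cwm => ->; rewrite mul0r ltxx.
have {}wp : w p = 0 by apply/eqP; move/eqP: cwp; rewrite mulf_eq0 (negbTE c0).
exists p; first by rewrite ap ltW//; exact: lt_trans mb.
split=> //; rewrite leNgt; apply/negP => cp.
(* A positive derivative would make [c * w] positive just right of [p], against [neg]. *)
have [d d0 near_p] := derive1_sign_near (dw p) cp.
pose q := Num.min m (p + d / 2).
have pq : p < q by rewrite /q lt_min pm; lra.
have qm : q <= m by rewrite /q ge_min lexx.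
have qd : q <= p + d / 2 by rewrite /q ge_min lexx orbT.
have := near_p q; rewrite gt_eqF// => /(_ isT).
rewrite gtr0_norm ?subr_gt0// wp subr0 mulrCA pmulr_rgt0 ?subr_gt0// => h.
by have := neg _ pq qm; rewrite ltNge ltW// h//; lra.
Qed.

(* If [y] had no zero on [a, b], its sign there would prescribe the sign of
   [w'] at every zero of [w]. *)
Lemma zero_between_zeros (R : realType) (w y : R -> R) (d : R) :
  (forall t, derivable w t 1) -> continuous y ->
  (forall t, w t = 0 -> y t != 0 -> 0 < d * y t * derive1 w t) ->
  forall a b, a < b -> w a = 0 -> w b = 0 -> exists2 z, a <= z <= b & y z = 0.
Proof.
move=> dw yc feedback a b ab wa wb.
have [p /andP[ap pb] [wp sgn_p]] := zero_derive1_sign (d * y a) dw ab wa wb.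
have [z] : exists2 z, z \in `[a, p] & y z = 0.
  apply: IVT => //; first exact: continuous_subspaceT.
  rewrite ge_min le_max.
  have [->|yp0] := eqVneq (y p) 0; first by rewrite lexx !orbT.
  have := feedback p wp yp0.
  move: sgn_p; set a' := y a; set p' := y p; set w' := derive1 w p => h1 h2.
  have : a' * p' <= 0 by nra.
  move=> h; have [a0|a0] := leP 0 a'; have [p0|p0] := leP 0 p' => /=; nra.
by rewrite in_itv/= => /andP[az zp] yz; exists z => //; rewrite az (le_trans zp).
Qed.

(** * Limit points of zero sets *)

(** Of three points of [A] at decreasing distances from [s], two lie strictly on the same side of
    [s]; a point of [B] between them differs from [s] and is still close to it. *)
Lemma limit_point_between (R : realType) (A B : set R) (s : R) :
  (forall a b, a < b -> A a -> A b -> exists2 z, a <= z <= b & B z) ->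
  limit_point A s -> limit_point B s.
Proof.
move=> AB As U /nbhs_ballP[e /= e0 eU].
have pick d : 0 < d -> exists a, [/\ a != s, A a & `|s - a| < d].
  by move=> d0; have [a [? ? ?]] := As _ (nbhsx_ballx s d d0); exists a.
have [a1 [a1s A1 a1e]] := pick e e0.
have [|a2 [a2s A2 a2e]] := pick `|s - a1|; first by rewrite normr_gt0 subr_eq0 eq_sym.
have [|a3 [a3s A3 a3e]] := pick `|s - a2|; first by rewrite normr_gt0 subr_eq0 eq_sym.
have same_side a b : A a -> A b -> a < b -> `|s - a| < e -> `|s - b| < e ->
    (s < a) || (b < s) -> exists y, [/\ y != s, B y & U y].
  move=> Aa Ab ab; rewrite !ltr_distl => /andP[? ?] /andP[? ?] side.
  have [z /andP[az zb] Bz] := AB _ _ ab Aa Ab; exists z; split => //.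
    by case/orP: side => ?; [rewrite gt_eqF|rewrite lt_eqF]; lra.
  by apply: eU; rewrite /ball/= ltr_distl; apply/andP; split; lra.
have two a b : A a -> A b -> a != s -> b != s -> `|s - b| < `|s - a| -> `|s - a| < e ->
    (s < a) = (s < b) -> exists y, [/\ y != s, B y & U y].
  move=> Aa Ab a_s b_s ba ae side; have be := lt_trans ba ae.
  have [sa|sa] := ltP s a.
    rewrite sa in side; move: ba; rewrite !ltr0_norm ?subr_lt0// => ba.
    by apply: (same_side b a) => //; [lra|rewrite -side].
  have {}sa : a < s by rewrite lt_neqAle a_s.
  have bs : b < s by rewrite lt_neqAle b_s leNgt -side -leNgt ltW.
  move: ba; rewrite !gtr0_norm ?subr_gt0// => ba.
  by apply: (same_side a b) => //; [lra|rewrite bs orbT].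
have a2e' := lt_trans a2e a1e.
have [h12|h12] := eqVneq (s < a1) (s < a2); first exact: (two a1 a2).
have [h23|h23] := eqVneq (s < a2) (s < a3); first exact: (two a2 a3).
apply: (two a1 a3) => //; first exact: lt_trans a2e.
by move: h12 h23; case: (s < a1); case: (s < a2); case: (s < a3).
Qed.

Lemma limit_point_preimage (R : realType) (g : R -> R) (A : set R) (s : R) :
  continuous g -> {homo g : s t / s < t} ->
  limit_point [set t | A (g t)] s -> limit_point A (g s).
Proof.
move=> cg mono As U Us.
have [t [ts At Ut]] := As _ (cg s U Us); exists (g t); split=> //.
by rewrite (inj_eq (inc_inj (le_mono mono))).
Qed.

(** * The cyclic feedback structure and growth bounds *)

(** The last argument of [f i] along the solution; it gives all equations of the cycle one form, the
    delayed one included. *)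
Definition feedback_arg (R : realType) (N : nat) (eta : R -> R)
    (x : 'I_N.+1 -> R -> R) (i : 'I_N.+1) (t : R) : R :=
  if (i < N)%N then x (inord i.+1) t else x ord0 (eta t).

Section Solution.
Context {R : realType} {N : nat} {r delta : R}
  {f : 'I_N.+1 -> R -> R -> R -> R} {eta : R -> R} {x : 'I_N.+1 -> R -> R}.

Lemma solution_continuous : entire_solution f eta x ->
  forall i, continuous (x i).
Proof.
case=> dx _ _ i t; apply/differentiable_continuous/derivable1_diffP.
exact: (dx i).1.
Qed.

Lemma solution_feedback : entire_solution f eta x -> forall i t,
  derive1 (x i) t = f i t (x i t) (feedback_arg eta x i t).
Proof.
case=> _ sys sysN i t; rewrite /feedback_arg.
case: ltnP => iN; first by apply: sys; rewrite inordK.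
by rewrite (_ : i = ord_max) ?sysN//; apply/val_inj/eqP; rewrite eqn_leq -ltnS ltn_ord.
Qed.

Lemma feedback_arg_continuous : continuous eta ->
  entire_solution f eta x -> forall i, continuous (feedback_arg eta x i).
Proof.
move=> ceta xs i t; rewrite /feedback_arg; case: (i < N)%N.
  exact: solution_continuous.
apply: (@continuous_comp _ _ _ eta (x ord0)); first exact: ceta.
exact: solution_continuous.
Qed.

Lemma feedback_sign : delta = 1 \/ delta = -1 -> H2 delta f ->
  H4 f -> entire_solution f eta x -> forall i : 'I_N.+1, exists d : R,
  forall t, x i t = 0 -> feedback_arg eta x i t != 0 ->
    0 < d * feedback_arg eta x i t * derive1 (x i) t.
Proof.
move=> hdelta [h2 h2N] h4 xs i; case: (ltnP i N) => iN.
  exists 1 => t xt y0; rewrite (solution_feedback xs) xt mul1r.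
  exact: (h2 i iN t).1.
exists delta => t xt y0; rewrite (solution_feedback xs) xt.
have -> : i = ord_max by apply/val_inj/eqP; rewrite eqn_leq -ltnS ltn_ord.
by apply: (h2N t).1; move: y0; congr (feedback_arg eta x _ t != 0);
  apply/val_inj/eqP; rewrite eqn_leq -ltnS ltn_ord.
Qed.

Lemma backwards_uniform_bound : backwards_bounded x -> forall T : R,
  exists2 M : R, 0 < M & forall i t, t <= T -> `|x i t| <= M.
Proof.
move=> xb T.
have bnd : \forall M \near pinfty_nbhs R, forall i : 'I_N.+1,
    globally `]-oo, T] [set s | `|x i s| <= M].
  by apply: filter_forall => i; exact: xb.
have [M [M0 xM]] := filter_ex (filterI (nbhs_pinfty_gt (num_real 0)) bnd).
by exists M => // i t tT; apply: xM; rewrite /= in_itv.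
Qed.

(** A single constant serves all [t <= T]: since [eta t < t], both state arguments of [f i] are
    bounded by the bound of [x] on []-oo, T]], so (H4) is applied to one fixed ball. *)
Lemma solution_growth : (forall t, eta t < t) -> H4 f ->
  entire_solution f eta x -> backwards_bounded x -> forall T : R,
  exists2 C : R, 0 < C & forall i t, t <= T ->
    `|derive1 (x i) t| <= C * (`|x i t| + `|feedback_arg eta x i t|).
Proof.
move=> eta_lt h4 xs xb T.
have [M M0 xM] := backwards_uniform_bound xb T.
have Bb : bounded_set [set p : R * R | `|p| <= M].
  exists M; split; first exact: num_real.
  by move=> K MK p /= pM; exact: le_trans pM (ltW MK).
have [C C0 fC] := h4 _ Bb; exists C => // i t tT.
rewrite (solution_feedback xs); apply: fC; rewrite /= prod_normE/= ge_max xM//=.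
rewrite /feedback_arg; case: ifP => _; apply: xM => //.
exact: le_trans (ltW (eta_lt t)) tT.
Qed.

(** * Propagation of zeros along the iterates of [eta] *)

Lemma iter_eta_le : (forall t, eta t < t) -> forall k t, iter k eta t <= t.
Proof.
move=> eta_lt; elim=> //= k IH t; exact: le_trans (ltW (eta_lt _)) (IH t).
Qed.

(* By the mean value theorem and the common Lipschitz constant of the iterates,
   a bound [b] for all the [x i \o iter k eta] on [sigma, p] improves to
   [b / 2] on intervals of a length depending only on [T]. *)
Lemma zero_local : H3 r eta -> H4 f -> H5 eta -> entire_solution f eta x ->
  backwards_bounded x -> forall T : R, exists2 h : R, 0 < h &
  forall sigma, (forall k i, x i (iter k eta sigma) = 0) ->
  forall p, sigma <= p -> p <= sigma + h -> p <= T ->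
  forall k i, x i (iter k eta p) = 0.
Proof.
move=> [ceta mono del] h4 [L L0 lipL] xs xb T.
have eta_lt t : eta t < t by have /andP[] := del t; rewrite subr_gt0.
have [C C0 growth] := solution_growth eta_lt h4 xs xb T.
have [M M0 xM] := backwards_uniform_bound xb T.
have h0 : 0 < (4 * C * L)^-1 by rewrite invr_gt0 !mulr_gt0.
(* With this length, derivative bound times displacement is [C * (b + b) * (L * (4 * C * L)^-1)],
   which is [b / 2]. *)
exists (4 * C * L)^-1 => // sigma zs.
have citer k : continuous (iter k eta).
  by elim: k => [|k IH] t //=; apply: (@continuous_comp _ _ _ (iter k eta) eta);
    [exact: IH|exact: ceta].
have mono_iter k s t : s <= t -> iter k eta s <= iter k eta t.
  move=> st; elim: k => //= k; rewrite le_eqVlt => /predU1P[->//|/mono].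
  exact: ltW.
suff bnd n p : sigma <= p -> p <= sigma + (4 * C * L)^-1 -> p <= T ->
    forall k i, `|x i (iter k eta p)| <= M / 2 ^+ n.
  move=> p sp ph pT k i; apply/eqP; rewrite -normr_le0 leNgt; apply/negP => z0.
  have [n hn] : exists n : nat, M / `|x i (iter k eta p)| < 2 ^+ n.
    exists (Num.truncn (M / `|x i (iter k eta p)|)).+1.
    apply: lt_le_trans (truncnS_gt _) _.
    by rewrite -natrX ler_nat ltnW// ltn_expl.
  have := bnd n p sp ph pT k i; rewrite leNgt => /negP; apply.
  by rewrite ltr_pdivrMr ?exprn_gt0// mulrC -ltr_pdivrMr.
elim: n p => [|n IH] p sp ph pT k i.
  by rewrite expr0 divr1; apply: xM; exact: le_trans (iter_eta_le eta_lt k p) pT.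
have [c /[!in_itv]/= /andP[sc cp]] : exists2 c, c \in `[iter k eta sigma, iter k eta p] &
    x i (iter k eta p) - x i (iter k eta sigma) =
    derive1 (x i) c * (iter k eta p - iter k eta sigma).
  apply: MVT_segment; first exact: mono_iter.
    move=> t _; rewrite derive1E; apply: derivableP; case: xs => dx _ _.
    exact: (dx i).1.
  by apply: continuous_subspaceT => t; exact: solution_continuous.
rewrite zs subr0 => ->.
(* The mean value point is itself a [k]-th iterate of a point of [[sigma, p]], so the induction
   hypothesis bounds [x] there. *)
have [q] : exists2 q, q \in `[sigma, p] & iter k eta q = c.
  apply: IVT => //; first by apply: continuous_subspaceT; exact: citer.
  by rewrite ge_min le_max sc cp orbT.
rewrite in_itv/= => /andP[sq qp] qc.
have qh := le_trans qp ph; have qT := le_trans qp pT.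
have cT : c <= T by rewrite -qc; exact: le_trans (iter_eta_le eta_lt k q) qT.
have xc : `|x i c| <= M / 2 ^+ n by rewrite -qc; exact: IH.
have yc : `|feedback_arg eta x i c| <= M / 2 ^+ n.
  rewrite /feedback_arg -qc; case: ifP => _; first exact: IH.
  (* The delayed argument uses one more iterate; hence the induction treats all [k] at once. *)
  exact: (IH q sq qh qT k.+1).
have lip : `|iter k eta p - iter k eta sigma| <= L * (4 * C * L)^-1.
  have := lipL k (p, sigma) (conj I I); rewrite /= => /le_trans; apply.
  by rewrite ler_pM2l// ger0_norm ?subr_ge0// lerBlDl.
rewrite normrM exprS.
apply: le_trans (ler_pM (normr_ge0 _) (normr_ge0 _) (growth i c cT) lip) _.
set b := M / 2 ^+ n in xc yc.
have -> : M / (2 * 2 ^+ n) = C * (b + b) * (L * (4 * C * L)^-1).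
  rewrite /b; field; rewrite !lt0r_neq0 //.
by rewrite ler_pM2r ?mulr_gt0// ler_pM2l// lerD.
Qed.

(** The step [h] of [zero_local] is the same for all starting points once [T] is fixed, so finitely
    many steps lead from [sigma] to [T]. *)
Lemma zero_forward : H3 r eta -> H4 f -> H5 eta -> entire_solution f eta x ->
  backwards_bounded x -> forall sigma,
  (forall k i, x i (iter k eta sigma) = 0) ->
  forall t, sigma <= t -> forall i, x i t = 0.
Proof.
move=> h3 h4 h5 xs xb sigma zs T sT.
have [h h0 step] := zero_local h3 h4 h5 xs xb T.
suff zero_upto n p : sigma <= p -> p <= T -> p <= sigma + n%:R * h ->
    forall k i, x i (iter k eta p) = 0.
  apply: (zero_upto (Num.truncn ((T - sigma) / h)).+1 T sT (lexx _) _ 0%N).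
  by rewrite -lerBlDl -ler_pdivrMr// ltW// truncnS_gt.
elim: n p => [|n IH] p sp pT.
  rewrite mul0r addr0 => ps.
  by have -> : p = sigma by apply/eqP; rewrite eq_le sp ps.
move=> pn; have [pn'|pn'] := leP p (sigma + n%:R * h); first exact: IH.
apply: (step (sigma + n%:R * h)) => //; last 2 first.
- exact: ltW.
- by move: pn; rewrite -natr1 mulrDl mul1r addrA.
by apply: IH => //; [rewrite lerDl mulr_ge0// ltW|exact: ltW (lt_le_trans pn' pT)].
Qed.

(** The delay need not be bounded below on the whole line, but on the compact interval [[t, sigma]]
    it has a positive minimum, and each iterate that is still above [t] descends by at least this
    amount. *)
Lemma iter_eta_unbounded : H3 r eta -> forall sigma t : R,
  exists k, iter k eta sigma <= t.
Proof.
move=> [ceta _ del] sigma t.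
have [st|ts] := leP sigma t; first by exists 0%N.
have cdel : continuous (delay eta).
  by move=> s; apply: cvgB; [exact: cvg_id|exact: ceta].
have [c _ cmin] := EVT_min (ltW ts) (continuous_subspaceT cdel).
have d0 : 0 < delay eta c by have /andP[] := del c.
have eta_lt s : eta s < s by have /andP[] := del s; rewrite subr_gt0.
have descent k : iter k eta sigma <= t \/
    iter k eta sigma <= sigma - k%:R * delay eta c.
  elim: k => [|k IH]; first by right; rewrite mul0r subr0.
  have [kt|tk] := leP (iter k eta sigma) t.
    by left; apply: le_trans kt; exact: ltW (eta_lt _).
  case: IH => [/(lt_le_trans tk)|kd]; first by rewrite ltxx.
  right; have := cmin (iter k eta sigma).
  rewrite in_itv/= (ltW tk) iter_eta_le// => /(_ isT).
  rewrite -natr1 mulrDl mul1r /=; rewrite {2}/delay; lra.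
set k := (Num.truncn ((sigma - t) / delay eta c)).+1.
exists k; case: (descent k) => // /le_trans; apply.
have : (sigma - t) / delay eta c < k%:R by exact: truncnS_gt.
by rewrite ltr_pdivrMr//; lra.
Qed.

Lemma zero_solution : H3 r eta -> H4 f -> H5 eta -> entire_solution f eta x ->
  backwards_bounded x -> forall sigma,
  (forall k i, x i (iter k eta sigma) = 0) -> forall t i, x i t = 0.
Proof.
move=> h3 h4 h5 xs xb sigma zs t i.
have [k kt] := iter_eta_unbounded h3 sigma t.
(* The iterates of the new starting point [iter k eta sigma] are again iterates of [sigma]. *)
by apply: (zero_forward h3 h4 h5 xs xb _ kt) => m j; rewrite -iterD.
Qed.

(** * Limit points of zeros carried around the cycle *)

Lemma limit_point_zeros_feedback : delta = 1 \/ delta = -1 -> H2 delta f ->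
  H3 r eta -> H4 f -> entire_solution f eta x -> forall i s,
  limit_point [set t | x i t = 0] s ->
  limit_point [set t | feedback_arg eta x i t = 0] s.
Proof.
move=> hdelta h2 [ceta _ _] h4 xs i s; apply: limit_point_between.
have [d sgn] := feedback_sign hdelta h2 h4 xs i.
apply: zero_between_zeros sgn; last exact: feedback_arg_continuous.
by case: xs => dx _ _ t; exact: (dx i).1.
Qed.

Lemma limit_point_zeros_iter : delta = 1 \/ delta = -1 -> H2 delta f ->
  H3 r eta -> H4 f -> entire_solution f eta x -> forall s,
  limit_point [set t | x ord0 t = 0] s ->
  forall k i, x i (iter k eta s) = 0.
Proof.
move=> hdelta h2 h3 h4 xs s lim0.
have lim_all s' : limit_point [set t | x ord0 t = 0] s' ->
    forall i : 'I_N.+1, limit_point [set t | x i t = 0] s'.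
  move=> lim_s' [i]; elim: i => [|i IH] iN.
    by rewrite (_ : Ordinal iN = ord0)//; exact: val_inj.
  have := limit_point_zeros_feedback hdelta h2 h3 h4 xs (IH (ltnW iN)).
  rewrite /feedback_arg/= -ltnS iN.
  by rewrite (_ : inord i.+1 = Ordinal iN)//; apply/val_inj; rewrite /= inordK.
(* Closing the cycle: component [N] is fed by [x ord0 \o eta], so each full turn moves the limit
   point from [s] to [eta s]. *)
have lim_iter k : limit_point [set t | x ord0 t = 0] (iter k eta s).
  elim: k => //= k IH; case: h3 => ceta mono del.
  have := limit_point_zeros_feedback hdelta h2 (And3 ceta mono del) h4 xs
    (lim_all _ IH ord_max).
  by rewrite /feedback_arg/= ltnn; exact: limit_point_preimage.
move=> k i.
have : closed [set t | x i t = 0].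
  apply: (@preimage_closed _ _ (x i) [set 0]); last exact: closed_eq.
  by move=> t _; exact: solution_continuous.
by apply; apply: subset_limit_point; exact: lim_all.
Qed.

End Solution.

(** * Sign changes and continuity of segments *)

Section Segment.
Context {R : realType} {N : nat}.

(* The values [theta i > 0] are decreasing integers in 1..N, so there are at
   most N of them; every later sign change encloses a zero in [a, 0]. *)
Lemma sc_finite (phi : R -> R) (a : R) :
  {within `[a, 0], continuous phi} ->
  finite_set [set s | a <= s <= 0 /\ phi s = 0] ->
  exists n, sc N phi a = Fin n.
Proof.
move=> cphi /finite_seqP[zs zsE]; rewrite /sc /natsup.
set A := (X in has_ubound X); suff : has_ubound A.
  by move=> uA; exists (supremum 0%N A); case: asboolP.
exists (N + size zs)%N => k [_ [theta [dom sign]]].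
rewrite leEnat leqNgt; apply/negP => ltk.
have step i : (i < k)%N -> theta i.+1 < theta i /\ phi (theta i.+1) * phi (theta i) < 0.
  by move=> ik; exact: (sign i.+1).
have int_or_nonpos i : (i <= k)%N -> theta i <= 0 \/
    (* Each further index lowers a positive integer value by at least one, starting from at most
       [N]. *)
    exists2 m, (m + i <= N)%N & theta i = m%:R.
  elim: i => [|i IH] ik.
    case: (dom 0%N ik) => [|[m /= /andP[_ mN] <-]]; last by right; exists m; rewrite ?addn0.
    by rewrite /= in_itv/= => /andP[_ ?]; left.
  have [lt_i _] := step i ik.
  case: (IH (ltnW ik)) => [i0|[m mN im]]; first by left; exact: ltW (lt_le_trans lt_i i0).
  case: (dom i.+1 ik) => [|[m' /= _ m'E]].
    by rewrite /= in_itv/= => /andP[_ ?]; left.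
  right; exists m' => //; move: lt_i; rewrite -m'E im ltr_nat => m'm.
  by rewrite addnS; apply: leq_trans mN; rewrite -addSn leq_add2r.
have nonpos i : (N <= i)%N -> (i <= k)%N -> a <= theta i <= 0.
  move=> Ni ik; case: (int_or_nonpos i ik) => [i0|[m mN im]].
    case: (dom i ik) => [|[m' /= /andP[m'0 _] m'E]]; first by rewrite /= in_itv.
    by move: i0; rewrite -m'E -(ler_nat R) in m'0 *; lra.
  (* For [i >= N] only [m = 0] is left, whereas the integer points of the domain start at 1. *)
  have m0 : m = 0%N by apply/eqP; rewrite -leqn0 -(leq_add2r i) add0n (leq_trans mN).
  case: (dom i ik) => [|[m' /= /andP[m'0 _] m'E]]; first by rewrite /= in_itv.
  by move: im; rewrite -m'E m0 => /eqP; rewrite (eqr_nat R m' 0) -leqn0 leqNgt m'0.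
have antitone i j : (i <= j)%N -> (j <= k)%N -> theta j <= theta i.
  elim: j => [|j IH]; first by rewrite leqn0 => /eqP->.
  rewrite leq_eqVlt => /predU1P[->//|]; rewrite ltnS => ij jk.
  exact: le_trans (ltW (step j jk).1) (IH ij (ltnW jk)).
(* The range condition sits under the existential so that [choice] applies to all [i]; outside the
   range the value is 0. *)
have zero i : exists z : R, (N <= i < k)%N ->
    [/\ theta i.+1 < z, z < theta i & z \in zs].
  case: (boolP (N <= i < k)%N) => [/andP[Ni ik]|]; last by exists 0.
  have [lt_i sgn] := step i ik.
  have /andP[a1 _] := nonpos _ (leqW Ni) ik.
  have /andP[_ i0] := nonpos _ Ni (ltnW ik).
  have [z] : exists2 z, z \in `[theta i.+1, theta i] & phi z = 0.
    apply: IVT; first exact: ltW.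
      apply: continuous_subspaceW cphi => s; rewrite /= !in_itv/= => /andP[s1 s2].
      by rewrite (le_trans a1)//= (le_trans s2).
    rewrite ge_min le_max; case: (ltrgt0P (phi (theta i.+1))) sgn => [u0|u0|->] /=.
    - by rewrite pmulr_rlt0// => /ltW->; rewrite ?orbT.
    - by rewrite nmulr_rlt0// => /ltW->; rewrite ?orbT.
    - by [].
  rewrite in_itv/= => /andP[z1 z2] z0; exists z => _; split.
  - by rewrite lt_neqAle z1 andbT; apply: contraTneq sgn => ->; rewrite z0 mul0r ltxx.
  - by rewrite lt_neqAle z2 andbT; apply: contraTneq sgn => <-; rewrite z0 mulr0 ltxx.
  - have : [set` zs] z by rewrite -zsE /= z0 (le_trans a1 z1) (le_trans z2 i0).
    by [].
have [z zP] := choice zero.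
have z_lt i j : (N <= i)%N -> (i < j)%N -> (j < k)%N -> z j < z i.
  move=> Ni ij jk.
  have [|_ zj _] := zP j; first by rewrite jk (leq_trans Ni (ltnW ij)).
  have [|zi _ _] := zP i; first by rewrite Ni (ltn_trans ij).
  exact: lt_trans zj (le_lt_trans (antitone _ _ ij (ltnW jk)) zi).
(* The indices from [N] to [N + size zs] yield [size zs + 1] distinct members of [zs], which is
   absurd. *)
have : uniq [seq z i | i <- iota N (size zs).+1].
  rewrite map_inj_in_uniq ?iota_uniq// => i j.
  rewrite !mem_iota !addnS !ltnS => /andP[Ni iN] /andP[Nj jN] zij.
  case: (ltngtP i j) => // ij.
  - by have := z_lt i j Ni ij (leq_ltn_trans jN ltk); rewrite zij ltxx.
  - by have := z_lt j i Nj ij (leq_ltn_trans iN ltk); rewrite zij ltxx.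
move=> /uniq_leq_size => /(_ zs); rewrite size_map size_iota ltnn => abs.
suff : false by []; apply: abs => _ /mapP[i + ->].
rewrite mem_iota addnS ltnS => /andP[Ni iN].
by have [] := zP i; rewrite // Ni (leq_ltn_trans iN).
Qed.

(** Points of the domain below 1 lie in [[a, 0]], where the segment is a translate of [x ord0]; each
    positive integer is an isolated point of the domain. *)
Lemma segment_continuous (x : 'I_N.+1 -> R -> R) (t a : R) :
  continuous (x ord0) -> {within domK N a, continuous (segment x t)}.
Proof.
move=> cx; apply/subspace_continuousP => s ds; apply/cvgrPdist_lt => e e0.
have [s0|s0] := leP s 0.
  have cx0 : x ord0 (t + u) @[u --> s] --> x ord0 (t + s).
    apply: (@continuous_comp _ _ _ (fun u => t + u) (x ord0)); last exact: cx.
    by apply: cvgD; [exact: cvg_cst|exact: cvg_id].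
  have near_x := cvgr_dist_lt _ _ cx0 _ e0.
  have near1 : \forall u \near s, u < 1.
    have s1 : s < 1 by exact: le_lt_trans s0 ltr01.
    exact: cvgr_lt _ (@cvg_id _ (nbhs s)) _ s1.
  near=> u.
  have du : domK N a u by near: u; exact: withinT.
  have u1 : u < 1 by near: u; exact: cvg_within near1.
  have u0 : u <= 0.
    case: du => [|[j /= /andP[j1 _] ju]]; first by rewrite /= in_itv/= => /andP[].
    by move: u1; rewrite -ju (ltr_nat R j 1) ltnNge j1.
  rewrite /from_subspace /segment s0 u0; near: u.
  exact: cvg_within (near_x _).
case: ds => [|[j /= j1 js]]; first by rewrite /= in_itv/= => /andP[_]; rewrite leNgt s0.
near=> u.
have du : domK N a u by near: u; exact: withinT.
have us : `|s - u| < 1.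
  near: u; apply: cvg_within; exact: cvgr_dist_lt _ _ (@cvg_id _ (nbhs s)) _ ltr01.
suff -> : u = s by rewrite subrr normr0.
move: us; rewrite ltr_distlC => /andP[us1 us2].
case: du => [|[i /= i1 iu]].
  rewrite /= in_itv/= => /andP[_ u0].
  have : (1 : R) <= s by rewrite -js ler1n; case/andP: j1.
  by lra.
move: us1 us2; rewrite -js -iu ltrBlDr natr1 [_ + 1]natr1 !ltr_nat !ltnS => ij ji.
by congr _%:R; apply/eqP; rewrite eqn_leq ij ji.
Unshelve. all: by end_near. Qed.

End Segment.

(** * Trivial solutions, and finiteness of [V] along nontrivial ones *)

Theorem theorem3p9 (R : realType) (N : nat) (r delta : R)
  (f : 'I_N.+1 -> R -> R -> R -> R) (eta : R -> R) (x : 'I_N.+1 -> R -> R)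
  (r_gt0 : 0 < r) (delta_sign : delta = 1 \/ delta = -1)
  (h1 : H1 f) (h2 : H2 delta f) (h3 : H3 r eta) (h4 : H4 f) (h5 : H5 eta)
  (x_sol : entire_solution f eta x) (x_bnd : backwards_bounded x) :
  ((exists sigma : R, forall (k : nat) (i : 'I_N.+1), x i (iter k eta sigma) = 0) ->
     forall (t : R) (i : 'I_N.+1), x i t = 0) /\
  (~ (forall (t : R) (i : 'I_N.+1), x i t = 0) ->
     forall t : R,
       nonzeroCK N r (segment x t) /\
       exists n : nat, V N delta (segment x t) (- delay eta t) = Fin n).
Proof.
split=> [[sigma zs]|nontrivial t]; first exact: (zero_solution h3 h4 h5 x_sol x_bnd zs).
have isolated s : ~ limit_point [set u | x ord0 u = 0] s.
  move=> lim_s; apply: nontrivial; apply: (zero_solution h3 h4 h5 x_sol x_bnd (sigma := s)).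
  exact: (limit_point_zeros_iter delta_sign h2 h3 h4 x_sol lim_s).
have cseg a : {within domK N a, continuous (segment x t)}.
  by apply: segment_continuous; exact: (solution_continuous x_sol).
split.
  split; first exact: cseg.
  apply: contrapT => zero_seg; apply: (isolated t) => U /nbhs_ballP[e /= e0 eU].
  (* This choice puts [t - d] both in the window [[t - r, t]], where [x ord0] would vanish, and in
     the given neighbourhood of [t]. *)
  pose d := Num.min r (e / 2).
  have d0 : 0 < d by rewrite /d lt_min r_gt0; lra.
  have dr : d <= r by rewrite /d ge_min lexx.
  have de : d <= e / 2 by rewrite /d ge_min lexx orbT.
  exists (t - d); split; first by rewrite lt_eqF//; lra.
    apply/eqP/negP => xd; apply: zero_seg; exists (- d).
      by left; rewrite /= in_itv/=; apply/andP; split; lra.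
    by rewrite /segment oppr_le0 ltW//; apply/negP.
  by apply: eU; rewrite /ball/= opprB addrC subrK gtr0_norm//; lra.
have /andP[delay_gt0 delay_le] : 0 < delay eta t <= r by case: h3.
suff [n scE] : exists n, sc N (segment x t) (- delay eta t) = Fin n.
  by rewrite /V scE; case: eqP => _; eexists.
apply: sc_finite.
  by apply: continuous_subspaceW (cseg (- delay eta t)) => s; left.
(* By Bolzano-Weierstrass, infinitely many zeros of the segment accumulate at some [s]; translation
   by [t] turns [s] into a limit point of zeros of [x ord0]. *)
apply: contrapT => /infinite_bounded_limit_point_nonempty[|s lim_s].
  exists (delay eta t); split; first exact: num_real.
  move=> M ltM s /= [/andP[s1 s2] _]; rewrite ler0_norm//; lra.
apply: (isolated (t + s)).
apply: (@limit_point_preimage _ (fun u => t + u)).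
- by move=> u; apply: cvgD; [exact: cvg_cst|exact: cvg_id].
- by move=> u v uv; rewrite ltrD2l.
move=> U /lim_s[y [ys [/andP[_ y0] xy] Uy]]; exists y; split => //=.
by move: xy; rewrite /segment y0.
Qed.
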